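(* Let $A,B\in\mathbb{C}^{n\times n}$ be normal matrices with eigenvalues $\lambda_{A,1},\dots,\lambda_{A,n}$ and $\lambda_{B,1},\dots,\lambda_{B,n}$, respectively, ordered such that $$0\le\mathrm{Re}(\lambda_{A,1})\le\dots\le\mathrm{Re}(\lambda_{A,n}),\qquad 0\le\mathrm{Re}(\lambda_{B,1})\le\dots\le\mathrm{Re}(\lambda_{B,n}),$$ with $\mathrm{Re}(\lambda_{A,1})+\mathrm{Re}(\lambda_{B,1})>0$. Let $C,D\in\mathbb{C}^{n\times s}$ and let $X$ be the solution of the Sylvester equation $AX+XB+CD^*=0$. Let $\|\cdot\|$ denote either the Frobenius norm or the spectral norm. If the compress-and-restart block Krylov method described in the context, with residual tolerance $\varepsilon$ and compression tolerance $\delta$, terminates (by satisfying its residual test) in the cycle with index $\bar k<k_{\max}$, then the returned approximate solution $X^{(\bar k)}$ satisfies $$\|X^{(\bar k)}-X\|\le\frac{1}{\mathrm{Re}(\lambda_{A,1})+\mathrm{Re}(\lambda_{B,1})}\bigl(\varepsilon+(\bar k+1)\delta\bigr)+(\bar k+1)\delta.$$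
   Context: $M^*$ denotes the conjugate transpose. The norm $\|\cdot\|$ (Frobenius or spectral) is fixed and is the one used in the residual test and in the compression steps below. Compression: $\mathrm{Compress}(P,Q,\delta)$, for $P,Q\in\mathbb{C}^{n\times p}$, computes a singular value decomposition of $PQ^*$, truncates the smallest singular values so that the truncation error in $\|\cdot\|$ is at most $\delta$, and returns factors $\widetilde P,\widetilde Q$ with $\widetilde P\widetilde Q^*$ equal to the truncated SVD; thus $\|PQ^*-\widetilde P\widetilde Q^*\|\le\delta$. Compress-and-restart method (in exact arithmetic). Inputs: $A,B\in\mathbb{C}^{n\times n}$, $C,D\in\mathbb{C}^{n\times s}$, a memory bound $\mathtt{mem}_{\max}$, a maximum cycle index $k_{\max}$, tolerances $\varepsilon,\delta>0$. Initialize $C^{(0)}=C$, $D^{(0)}=D$, $X^{(-1)}=0$. For $k=0,1,\dots,k_{\max}$: 1. Let $s_k$ be the number of columns of $C^{(k)}$ and $D^{(k)}$ (equal to their rank), and set $m_k=\lfloor \mathtt{mem}_{\max}/(2s_k)\rfloor-2$. 2. For $j=1,\dots,m_k$: using the block Arnoldi process (assumed to run without rank-deficient block basis vectors), compute matrices $\mathcal U_j=[U_1|\cdots|U_j]$ and $\mathcal V_j=[V_1|\cdots|V_j]$ with orthonormal columns, with blocks of size $n\times s_k$, spanning the block Krylov subspaces $\mathrm{colspan}\{C^{(k)},AC^{(k)},\dots,A^{j-1}C^{(k)}\}$ and $\mathrm{colspan}\{D^{(k)},B^*D^{(k)},\dots,(B^* )^{j-1}D^{(k)}\}$, respectively, and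 satisfying $$A\mathcal U_j=\mathcal U_j\mathcal H_j+U_{j+1}H_{j+1,j}E_j^*,\qquad B^*\mathcal V_j=\mathcal V_j\mathcal G_j+V_{j+1}G_{j+1,j}E_j^*,$$ where $\mathcal H_j=\mathcal U_j^*A\mathcal U_j$, $\mathcal G_j=\mathcal V_j^*B^*\mathcal V_j$, and $E_j$ consists of the last $s_k$ columns of the $js_k\times js_k$ identity matrix. Compute the solution $Y$ of the projected equation $\mathcal H_jY+Y\mathcal G_j^*+(\mathcal U_j^*C^{(k)})(\mathcal V_j^*D^{(k)})^*=0$. Compute the norm of the residual $A\,\mathcal U_jY\mathcal V_j^*+\mathcal U_jY\mathcal V_j^*B+C^{(k)}(D^{(k)})^*$. If this norm is $\le\varepsilon$, then set $m_k:=j$, set a convergence flag, and leave the inner loop. 3. With $j=m_k$, put $Z^{(k)}=\mathcal U_{m_k}Y\mathcal V_{m_k}^*$ and $R^{(k)}=AZ^{(k)}+Z^{(k)}B+C^{(k)}(D^{(k)})^*$. Let $X^{(k)}$ be the result of compressing (with tolerance $\delta$) a factored form of $X^{(k-1)}+Z^{(k)}$, so that $\|X^{(k-1)}+Z^{(k)}-X^{(k)}\|\le\delta$. 4. If the convergence flag is set, terminate and return $X^{(k)}$ (in factored form). Otherwise, factor $R^{(k)}=\widehat C\widehat D^*$ with $\widehat C=[U_{m_k+1}H_{m_k+1,m_k}\,|\,\mathcal U_{m_k}YE_{m_k}]$ and $\widehat D=[\mathcal V_{m_k}Y^*E_{m_k}\,|\,V_{m_k+1}G_{m_k+1,m_k}]$,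 and set $[C^{(k+1)},D^{(k+1)}]=\mathrm{Compress}(\widehat C,\widehat D,\delta)$, so that $\|R^{(k)}-C^{(k+1)}(D^{(k+1)})^*\|\le\delta$. Here $\bar k$ is the value of $k$ (number of restarts) at which the method terminates through the convergence flag. *)

(* Defs.v *)
From HB Require Import structures.
From mathcomp Require Import all_boot all_order all_algebra.
From mathcomp Require Import complex.
From mathcomp Require Import all_classical all_reals.

Set Implicit Arguments.
Unset Strict Implicit.
Unset Printing Implicit Defensive.

Import Order.TTheory GRing.Theory Num.Theory.

Open Scope complex_scope.
Open Scope sesquilinear_scope.
Open Scope ring_scope.

(* M ^t* is the conjugate transpose. *)

Section MatrixNorms.
Variable R : realType.

Definition frobenius_norm p q (M : 'M[R[i]]_(p, q)) : R :=
  Num.sqrt (\sum_i \sum_j complex.Re `|M i j| ^+ 2).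

(* The operator norm induced by the Euclidean norm; on column vectors
   frobenius_norm is the Euclidean norm. *)
Definition spectral_norm p q (M : 'M[R[i]]_(p, q)) : R :=
  sup [set frobenius_norm (M *m x) |
        x in [set x : 'cV[R[i]]_q | frobenius_norm x <= 1]]%classic.

Inductive norm_kind := Frobenius | Spectral.

Definition mxnorm (nk : norm_kind) p q (M : 'M[R[i]]_(p, q)) : R :=
  match nk with
  | Frobenius => frobenius_norm M
  | Spectral => spectral_norm M
  end.

End MatrixNorms.

Section Compression.
Variables (R : realType) (nk : norm_kind) (delta : R) (n : nat).

Definition is_svd (M U V : 'M[R[i]]_n) (sigma : 'I_n -> R) : Prop :=
  [/\ U \is unitarymx, V \is unitarymx,
      forall i, 0 <= sigma i,
      forall i j : 'I_n, (i <= j)%N -> sigma j <= sigma i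
    & M = U *m diag_mx (\row_i (sigma i)%:C) *m V ^t*].

Definition truncate (r : nat) (sigma : 'I_n -> R) (i : 'I_n) : R :=
  if (i < r)%N then sigma i else 0.

(* (P', Q') is an admissible output of Compress(P, Q, delta); the number r of
   retained singular values is not required to be the smallest possible. *)
Definition compress p q (P Q : 'M[R[i]]_(n, p)) (P' Q' : 'M[R[i]]_(n, q)) :
    Prop :=
  exists (U V : 'M[R[i]]_n) (sigma : 'I_n -> R) (r : nat),
    [/\ is_svd (P *m Q ^t* ) U V sigma,
        (r <= n)%N,
        P' *m Q' ^t* =
          U *m diag_mx (\row_i (truncate r sigma i)%:C) *m V ^t*
      & mxnorm nk (P *m Q ^t* - P' *m Q' ^t* ) <= delta].

Definition compress_product (M M' : 'M[R[i]]_n) : Prop :=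
  exists p q (P Q : 'M[R[i]]_(n, p)) (P' Q' : 'M[R[i]]_(n, q)),
    [/\ M = P *m Q ^t*, compress P Q P' Q' & M' = P' *m Q' ^t*].

End Compression.

Section BlockArnoldi.
Variables (R : realType) (n s : nat).
Implicit Types (A B : 'M[R[i]]_n) (C D : 'M[R[i]]_(n, s)).
Implicit Types U V : nat -> 'M[R[i]]_(n, s).

(* [U_1 | ... | U_j]; the value U 0 is never used. *)
Definition blocks U (j : nat) : 'M[R[i]]_(n, \sum_(i < j) s) :=
  \mxrow_(i < j) U i.+1.

Definition block_krylov A C (j : nat) : 'M[R[i]]_(n, \sum_(i < j) s) :=
  \mxrow_(i < j) (A ^+ i *m C).

(* E_j: the last s columns of the identity matrix of size j s. *)
Definition last_cols (j : nat) : 'M[R[i]]_(\sum_(i < j) s, s) :=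
  \matrix_(a, b) (a == (\sum_(i < j) s - s + b)%N :> nat)%:R.

(* After step j of the block Arnoldi process; S j is the subdiagonal block
   of index (j+1, j).  Column spaces are compared as the row spaces of the
   transposes.  The block U_{j+1} is subject only to the Arnoldi relation, so
   that a breakdown at the very last step is not excluded. *)
Definition arnoldi A C U (S : nat -> 'M[R[i]]_s) (j : nat) : Prop :=
  [/\ (blocks U j) ^t* *m blocks U j = 1%:M,
      ((blocks U j)^T :=: (block_krylov A C j)^T)%MS
    & A *m blocks U j =
        blocks U j *m ((blocks U j) ^t* *m A *m blocks U j)
        + U j.+1 *m S j *m (last_cols j) ^t*].

(* Quantities computed by the inner loop of one cycle: subH j = H_{j+1,j},
   subG j = G_{j+1,j}, and solY j solves the equation projected at step j. *)
Record krylov_data := KrylovData {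
  blkU : nat -> 'M[R[i]]_(n, s);
  blkV : nat -> 'M[R[i]]_(n, s);
  subH : nat -> 'M[R[i]]_s;
  subG : nat -> 'M[R[i]]_s;
  solY : forall j : nat, 'M[R[i]]_(\sum_(i < j) s)
}.

Definition inner_step A B C D (K : krylov_data) (j : nat) : Prop :=
  let Uj := blocks (blkU K) j in
  let Vj := blocks (blkV K) j in
  let Hj := Uj ^t* *m A *m Uj in
  let Gj := Vj ^t* *m B ^t* *m Vj in
  [/\ arnoldi A C (blkU K) (subH K) j,
      arnoldi (B ^t* ) D (blkV K) (subG K) j
    & Hj *m solY K j + solY K j *m Gj ^t*
        + (Uj ^t* *m C) *m (Vj ^t* *m D) ^t* = 0].

Definition correction (K : krylov_data) (j : nat) : 'M[R[i]]_n :=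
  blocks (blkU K) j *m solY K j *m (blocks (blkV K) j) ^t*.

Definition residual A B C D (K : krylov_data) (j : nat) : 'M[R[i]]_n :=
  A *m correction K j + correction K j *m B + C *m D ^t*.

Definition hatC (K : krylov_data) (m : nat) : 'M[R[i]]_(n, s + s) :=
  row_mx (blkU K m.+1 *m subH K m)
         (blocks (blkU K) m *m solY K m *m last_cols m).

Definition hatD (K : krylov_data) (m : nat) : 'M[R[i]]_(n, s + s) :=
  row_mx (blocks (blkV K) m *m (solY K m) ^t* *m last_cols m)
         (blkV K m.+1 *m subG K m).

End BlockArnoldi.

(* Truncated subtraction and x %/ 0 = 0 give 0 whenever the informal value
   is not a positive integer; every cycle below requires at least one step. *)
Definition max_steps (mem s : nat) : nat := (mem %/ (2 * s) - 2)%N.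

Section CompressAndRestart.
Variables (R : realType) (nk : norm_kind) (n s : nat).
Variables (A B : 'M[R[i]]_n) (C D : 'M[R[i]]_(n, s)).
Variables (mem kmax : nat) (eps delta : R).

Definition cycle_steps t (Ck Dk : 'M[R[i]]_(n, t)) (K : krylov_data R n t)
    (m : nat) : Prop :=
  [/\ \rank Ck = t, \rank Dk = t, (0 < m)%N
    & forall j, (0 < j <= m)%N -> inner_step A B Ck Dk K j].

Definition passes_test t (Ck Dk : 'M[R[i]]_(n, t)) (K : krylov_data R n t)
    (j : nat) : Prop :=
  mxnorm nk (residual A B Ck Dk K j) <= eps.

Definition unconverged_cycle t (Ck Dk : 'M[R[i]]_(n, t))
    (K : krylov_data R n t) (m : nat) : Prop :=
  [/\ m = max_steps mem t, cycle_steps Ck Dk K m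
    & forall j, (0 < j <= m)%N -> ~ passes_test Ck Dk K j].

Definition converged_cycle t (Ck Dk : 'M[R[i]]_(n, t))
    (K : krylov_data R n t) (m : nat) : Prop :=
  [/\ (m <= max_steps mem t)%N, cycle_steps Ck Dk K m,
      forall j, (0 < j < m)%N -> ~ passes_test Ck Dk K j
    & passes_test Ck Dk K m].

(* cycle_start k Ck Dk Xp: the method enters cycle k with C^(k) = Ck,
   D^(k) = Dk and X^(k-1) = Xp. *)
Inductive cycle_start : nat ->
    forall t, 'M[R[i]]_(n, t) -> 'M[R[i]]_(n, t) -> 'M[R[i]]_n -> Prop :=
| first_cycle : (* X^(-1) = 0 *)
    cycle_start 0 C D 0
| next_cycle k t (Ck Dk : 'M[R[i]]_(n, t)) (Xp : 'M[R[i]]_n)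
    (K : krylov_data R n t) (m : nat)
    u (Ck' Dk' : 'M[R[i]]_(n, u)) (Xk : 'M[R[i]]_n) :
    cycle_start k Ck Dk Xp ->
    (k < kmax)%N ->
    unconverged_cycle Ck Dk K m ->
    compress_product nk delta (Xp + correction K m) Xk ->
    compress nk delta (hatC K m) (hatD K m) Ck' Dk' ->
    cycle_start k.+1 Ck' Dk' Xk.

(* The residual test is met in cycle k, and Xk = X^(k) is returned. *)
Definition terminates_with (k : nat) (Xk : 'M[R[i]]_n) : Prop :=
  exists t (Ck Dk : 'M[R[i]]_(n, t)) (Xp : 'M[R[i]]_n)
    (K : krylov_data R n t) (m : nat),
    [/\ cycle_start k Ck Dk Xp, converged_cycle Ck Dk K m
      & compress_product nk delta (Xp + correction K m) Xk].

End CompressAndRestart.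

Section Eigenvalues.
Variables (R : realType) (n : nat).

(* lam lists the eigenvalues of A with algebraic multiplicity, by
   nondecreasing real part. *)
Definition ordered_eigenvalues (A : 'M[R[i]]_n) (lam : 'I_n -> R[i]) : Prop :=
  char_poly A = \prod_(i < n) ('X - (lam i)%:P) /\
  (forall i j : 'I_n, (i <= j)%N ->
     complex.Re (lam i) <= complex.Re (lam j)).

End Eigenvalues.

(* Main.v *)
(** With [Z^(k)] the corrections and [W] their sum, the restarts telescope:
    [A W + W B + C D^*] equals the last residual plus the [kbar] truncation
    errors of the residual factors, while [X^(kbar) - W] is the sum of the
    [kbar + 1] truncation errors of the iterates.  With [E = W - X], it remains
    to prove
    [(a + b) |E| <= |A E + E B|], where [a], [b] bound the real parts of the
    spectra from below.  By normality [Re <Y, A Y> >= a |Y|^2], and likewise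
    for [B].  In the Frobenius norm, pair [A E + E B] with [E] and apply
    Cauchy-Schwarz.  In the spectral norm, pair [(A E + E B) v] with [E v],
    where [v] is a top right singular vector of [E], so that [E^* E v = d v]
    with [d = |E|^2]. *)
Require Import Defs.
From HB Require Import structures.
From mathcomp Require Import all_boot all_order all_algebra.
From mathcomp Require Import complex.
From mathcomp Require Import all_classical all_reals.
From mathcomp Require Import ring lra.
Import Order.TTheory GRing.Theory Num.Theory.

Set Implicit Arguments.
Unset Strict Implicit.
Unset Printing Implicit Defensive.

(** * The real inner product on complex matrices and the Frobenius norm *)

Section RealInnerProduct.
Context {R : realType}.
Local Notation C := R[i].

Lemma ReD (x y : C) : complex.Re (x + y) = complex.Re x + complex.Re y.
Proof. by case: x; case: y. Qed.

Lemma ReN (x : C) : complex.Re (- x) = - complex.Re x.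
Proof. by case: x. Qed.

Lemma Re_sum (I : finType) (F : I -> C) :
  complex.Re (\sum_i F i) = \sum_i complex.Re (F i).
Proof. exact: (big_morph (@complex.Re R) ReD). Qed.

Lemma Re_realM (a : R) (x : C) : complex.Re (a%:C * x) = a * complex.Re x.
Proof. by case: x => u v /=; rewrite mul0r subr0. Qed.

Lemma Re_conjC (x : C) : complex.Re x^*%R = complex.Re x.
Proof. by case: x. Qed.

Lemma sqr_Re_norm (x : C) : (complex.Re `|x|) ^+ 2 = complex.Re (x^*%R * x).
Proof.
rewrite normc_def; case: x => u v /=; rewrite sqr_sqrtr ?addr_ge0 ?sqr_ge0 //.
by rewrite !expr2 mulNr opprK.
Qed.

Lemma adjoint_mulmx m n p (X : 'M[C]_(m, n)) (Y : 'M[C]_(n, p)) :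
  (X *m Y) ^t* = Y ^t* *m X ^t*.
Proof. by rewrite trmx_mul map_mxM. Qed.

(** The real part of the Frobenius inner product: a symmetric form, bilinear over the reals, in
    which real parts of eigenvalues appear directly. *)
Definition re_dot p q (X Y : 'M[C]_(p, q)) : R := complex.Re (\tr (X ^t* *m Y)).

Lemma re_dotE p q (X Y : 'M[C]_(p, q)) :
  re_dot X Y = \sum_i \sum_j complex.Re ((X i j)^*%R * Y i j).
Proof.
rewrite /re_dot /mxtrace Re_sum exchange_big /=; apply: eq_bigr => i _.
rewrite mxE Re_sum; apply: eq_bigr => j _; by rewrite !mxE.
Qed.

Lemma re_dotC p q (X Y : 'M[C]_(p, q)) : re_dot X Y = re_dot Y X.
Proof.
rewrite !re_dotE; apply: eq_bigr => i _; apply: eq_bigr => j _.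
by rewrite -Re_conjC rmorphM /= conjCK mulrC.
Qed.

Lemma re_dotDr p q (X Y Z : 'M[C]_(p, q)) :
  re_dot X (Y + Z) = re_dot X Y + re_dot X Z.
Proof. by rewrite /re_dot mulmxDr mxtraceD ReD. Qed.

Lemma re_dotZr p q (a : R) (X Y : 'M[C]_(p, q)) :
  re_dot X (a%:C *: Y) = a * re_dot X Y.
Proof. by rewrite /re_dot -scalemxAr mxtraceZ Re_realM. Qed.

Lemma re_dotNr p q (X Y : 'M[C]_(p, q)) : re_dot X (- Y) = - re_dot X Y.
Proof. by rewrite /re_dot mulmxN raddfN ReN. Qed.

Lemma re_dotDl p q (X Y Z : 'M[C]_(p, q)) :
  re_dot (Y + Z) X = re_dot Y X + re_dot Z X.
Proof. by rewrite re_dotC re_dotDr !(re_dotC X). Qed.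

Lemma re_dotZl p q (a : R) (X Y : 'M[C]_(p, q)) :
  re_dot (a%:C *: Y) X = a * re_dot Y X.
Proof. by rewrite re_dotC re_dotZr (re_dotC X). Qed.

Lemma re_dot_mulmxr p q r (A : 'M[C]_(p, r)) X (Y : 'M[C]_(r, q)) :
  re_dot X (A *m Y) = re_dot (A ^t* *m X) Y.
Proof. by rewrite /re_dot adjoint_mulmx trmxCK mulmxA. Qed.

Lemma re_dot_adjoint p q (X Y : 'M[C]_(p, q)) :
  re_dot (X ^t*) (Y ^t*) = re_dot X Y.
Proof. by rewrite re_dotC /re_dot !trmxCK mxtrace_mulC. Qed.

Lemma re_dot_xx p q (X : 'M[C]_(p, q)) :
  re_dot X X = frobenius_norm X ^+ 2.
Proof.
rewrite re_dotE /frobenius_norm sqr_sqrtr; last first.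
  by apply: sumr_ge0 => i _; apply: sumr_ge0 => j _; rewrite sqr_ge0.
by apply: eq_bigr => i _; apply: eq_bigr => j _; rewrite sqr_Re_norm.
Qed.

Lemma frobenius_ge0 p q (X : 'M[C]_(p, q)) : 0 <= frobenius_norm X.
Proof. exact: sqrtr_ge0. Qed.

Lemma frobenius_eq0 p q (X : 'M[C]_(p, q)) : frobenius_norm X = 0 -> X = 0.
Proof.
move=> X0; have := re_dot_xx X; rewrite X0 expr0n /= re_dotE => S0.
have ge0 i j : 0 <= complex.Re ((X i j)^*%R * X i j).
  by rewrite -sqr_Re_norm sqr_ge0.
have ge0' i : 0 <= \sum_j complex.Re ((X i j)^*%R * X i j).
  exact: sumr_ge0.
apply/matrixP => i j; rewrite mxE.
have /eqP := S0; rewrite psumr_eq0 // => /allP /(_ i (mem_index_enum _)) /=.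
rewrite psumr_eq0 // => /allP /(_ j (mem_index_enum _)) /=.
rewrite -sqr_Re_norm sqrf_eq0 => /eqP n0; apply/eqP.
by rewrite -normr_eq0 normc_def; rewrite normc_def /= in n0; rewrite n0.
Qed.

Lemma re_dot_le p q (X Y : 'M[C]_(p, q)) :
  re_dot X Y <= frobenius_norm X * frobenius_norm Y.
Proof.
set x := frobenius_norm X; set y := frobenius_norm Y.
have [x0|x_neq0] := eqVneq x 0.
  by rewrite (frobenius_eq0 x0) x0 mul0r -(scale0r 0) re_dotZl mul0r.
have [y0|y_neq0] := eqVneq y 0.
  by rewrite (frobenius_eq0 y0) y0 mulr0 -(scale0r 0) re_dotZr mul0r.
have xy_gt0 : 0 < x * y.
  by rewrite mulr_gt0 // lt0r ?x_neq0 ?y_neq0 frobenius_ge0.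
(* [0 <= |y X - x Y|^2 = 2 x y (x y - <X, Y>)] *)
have : 0 <= re_dot (y%:C *: X + (- x)%:C *: Y) (y%:C *: X + (- x)%:C *: Y).
  by rewrite re_dot_xx sqr_ge0.
rewrite re_dotDr !re_dotDl !re_dotZr !re_dotZl !re_dot_xx -/x -/y.
rewrite (re_dotC Y X) => h.
rewrite -subr_ge0 -(pmulr_rge0 _ xy_gt0); nra.
Qed.

Lemma frobeniusD p q (X Y : 'M[C]_(p, q)) :
  frobenius_norm (X + Y) <= frobenius_norm X + frobenius_norm Y.
Proof.
rewrite -(@ler_pXn2r _ 2) ?nnegrE ?addr_ge0 ?frobenius_ge0 //.
rewrite -re_dot_xx re_dotDr !re_dotDl !re_dot_xx (re_dotC Y X).
have := re_dot_le X Y; lra.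
Qed.

Lemma frobeniusZ p q (a : R) (X : 'M[C]_(p, q)) :
  frobenius_norm (a%:C *: X) = `|a| * frobenius_norm X.
Proof.
apply/eqP; rewrite -(@eqrXn2 _ 2) ?mulr_ge0 ?frobenius_ge0 //.
rewrite exprMn -!re_dot_xx re_dotZr re_dotZl mulrA -expr2.
by rewrite real_normK ?num_real.
Qed.

Lemma frobenius0 p q : frobenius_norm (0 : 'M[C]_(p, q)) = 0.
Proof. by rewrite -(scale0r 0) (frobeniusZ 0) normr0 mul0r. Qed.

Lemma frobeniusN p q (X : 'M[C]_(p, q)) :
  frobenius_norm (- X) = frobenius_norm X.
Proof.
rewrite -scaleN1r -[-1](rmorphN1 (real_complex R)) frobeniusZ.
by rewrite normrN1 mul1r.
Qed.

Lemma frobenius_adjoint p q (X : 'M[C]_(p, q)) :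
  frobenius_norm (X ^t*) = frobenius_norm X.
Proof.
apply/eqP; rewrite -(@eqrXn2 _ 2) ?frobenius_ge0 // -!re_dot_xx.
by rewrite re_dot_adjoint.
Qed.

Lemma frobenius_unitary n q (P : 'M[C]_n) (X : 'M[C]_(n, q)) :
  P \is unitarymx -> frobenius_norm (P *m X) = frobenius_norm X.
Proof.
move=> Pu; apply/eqP; rewrite -(@eqrXn2 _ 2) ?frobenius_ge0 // -!re_dot_xx.
rewrite re_dot_mulmxr mulmxA -invmx_unitary //.
by rewrite mulVmx ?unitarymx_unit // mul1mx.
Qed.

End RealInnerProduct.

(** * Lower bounds for normal matrices, and top singular vectors *)

Section NormalMatrices.
Context {R : realType}.
Local Notation C := R[i].

Lemma Re_conj_mulC (d x : C) :
  complex.Re (x^*%R * (d * x)) = complex.Re d * complex.Re (x^*%R * x).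
Proof. by case: x => u v; case: d => e f /=; ring. Qed.

(** With [W = P X], of the same norm as [X], the right-hand side is the sum of [Re d_i |W_ij|^2],
    bounded term by term. *)
Lemma re_dot_unitary_diag n q (P : 'M[C]_n) (d : 'rV[C]_n) (a : R)
    (X : 'M[C]_(n, q)) :
  P \is unitarymx -> (forall i, a <= complex.Re (d 0 i)) ->
  a * frobenius_norm X ^+ 2 <= re_dot X (P ^t* *m diag_mx d *m P *m X).
Proof.
move=> Pu ad; rewrite -(frobenius_unitary X Pu) -!mulmxA re_dot_mulmxr trmxCK.
set W := P *m X.
rewrite -re_dot_xx !re_dotE mulr_sumr; apply: ler_sum => i _.
rewrite mulr_sumr; apply: ler_sum => j _.
have -> : (diag_mx d *m W) i j = d 0 i * W i j by rewrite mul_diag_mx mxE.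
by rewrite Re_conj_mulC mulrC [leRHS]mulrC -sqr_Re_norm ler_wpM2l ?sqr_ge0.
Qed.

(** From [P A = diag(d) P], row [i] of [P] is a left eigenvector; it is nonzero since [P] is
    invertible. *)
Lemma spectral_diag_eigenvalue n (A : 'M[C]_n) i :
  A \is normalmx -> eigenvalue A (spectral_diag A 0 i).
Proof.
move=> /orthomx_spectralP.
set P := spectralmx A; set d := spectral_diag A => AE.
have Pu : P \in unitmx := unitarymx_unit (spectral_unitarymx A).
apply/eigenvalueP; exists (row i P).
  rewrite -row_mul {1}AE !mulmxA mulmxV // mul1mx.
  by apply/rowP => j; rewrite mul_diag_mx !mxE.
apply/negP => /eqP r0.
have := congr1 (row i) (mulmxV Pu); rewrite row_mul r0 mul0mx => /rowP /(_ i).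
by rewrite !mxE eqxx => /esym /eqP; rewrite oner_eq0.
Qed.

(** The diagonal entries of the spectral decomposition are roots of the characteristic polynomial,
    hence occur in [lam], where index 0 has the least real part. *)
Lemma re_dot_normal n q (n_gt0 : (0 < n)%N) (A : 'M[C]_n) (lam : 'I_n -> C)
    (X : 'M[C]_(n, q)) :
  A \is normalmx -> ordered_eigenvalues A lam ->
  complex.Re (lam (Ordinal n_gt0)) * frobenius_norm X ^+ 2
    <= re_dot X (A *m X).
Proof.
move=> An [charA lam_le].
have /orthomx_spectralP AE := An; have Pu := spectral_unitarymx A.
rewrite AE invmx_unitary //; apply: re_dot_unitary_diag => // i.
have := spectral_diag_eigenvalue i An; rewrite eigenvalue_root_char charA.
rewrite -(big_map lam xpredT (fun a => 'X - a%:P)).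
rewrite root_prod_XsubC => /mapP [j _ ->].
exact: lam_le.
Qed.

(** Diagonalize the Hermitian matrix [H = M^* M]: [d] is its largest eigenvalue and [v] the matching
    column of [P^*]. *)
Lemma top_singular_vector n (M : 'M[C]_n) : (0 < n)%N ->
  exists (v : 'cV[C]_n) (d : R),
    [/\ frobenius_norm v = 1, M ^t* *m (M *m v) = d%:C *: v
      & forall x : 'cV[C]_n,
          frobenius_norm (M *m x) ^+ 2 <= d * frobenius_norm x ^+ 2].
Proof.
move=> n_gt0; pose H := M ^t* *m M.
have Hh : H \is hermsymmx.
  by apply/is_hermitianmxP; rewrite expr0 scale1r adjoint_mulmx trmxCK.
have /orthomx_spectralP := hermitian_normalmx Hh.
have := hermitian_spectral_diag_real Hh; have := spectral_unitarymx H.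
set P := spectralmx H; set D := spectral_diag H => Pu Dr.
rewrite invmx_unitary // => HE.
pose k := [arg max_(i > Ordinal n_gt0) complex.Re (D 0 i)]%O.
have kP i : complex.Re (D 0 i) <= complex.Re (D 0 k).
  by rewrite /k; case: arg_maxP => // j _; apply.
exists (P ^t* *m delta_mx k 0), (complex.Re (D 0 k)); split.
- rewrite frobenius_unitary ?trmxC_unitary //.
  apply/eqP; rewrite -(@eqrXn2 _ 2) ?frobenius_ge0 // -re_dot_xx re_dotE.
  rewrite (bigD1 k) //= big_ord1 !mxE !eqxx conjC1 mul1r big1 ?addr0 ?expr1n //.
  by move=> i ik; rewrite big_ord1 !mxE (negPf ik) mulr0.
- rewrite mulmxA -/H HE -!mulmxA (mulmxA P) (unitarymxP Pu) mul1mx scalemxAr.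
  congr (_ *m _); apply/matrixP => i j.
  rewrite mul_diag_mx !mxE !ord1 eqxx andbT.
  case: eqVneq => [->|_]; last by rewrite !mulr0.
  by rewrite RRe_real //; apply: (mxOverP Dr).
- move=> x; rewrite -re_dot_xx re_dot_mulmxr re_dotC mulmxA -/H.
  (* The sign change turns the upper bound [d] on the spectrum of [H] into the lower bound [-d] on
     that of [-H]. *)
  have -> : H *m x = - (P ^t* *m diag_mx (- D) *m P *m x).
    by rewrite {1}HE (raddfN (@diag_mx C n)) mulmxN !mulNmx opprK.
  rewrite re_dotNr lerNl -mulNr; apply: re_dot_unitary_diag => // i.
  by rewrite mxE ReN lerN2.
Qed.
End NormalMatrices.

(** * The spectral norm as an operator norm, and stability of the Sylvester operator *)

Section SpectralNorm.
Context {R : realType} {n : nat} (n_gt0 : (0 < n)%N).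
Local Notation C := R[i].
Implicit Types M N : 'M[C]_n.

(** Boundedness makes [sup] in [spectral_norm] a genuine supremum; the bound is the top singular
    value [Num.sqrt d]. *)
Lemma spectral_set_ubound M :
  has_ubound [set frobenius_norm (M *m x) |
    x in [set x : 'cV[C]_n | frobenius_norm x <= 1]]%classic.
Proof.
have [v [d [v1 Mv Mx]]] := top_singular_vector M n_gt0.
have d_ge0 : 0 <= d.
  by have := Mx v; rewrite v1 expr1n mulr1; apply: le_trans; rewrite sqr_ge0.
exists (Num.sqrt d) => _ [x /= x1 <-].
rewrite -(@ler_pXn2r _ 2) ?nnegrE ?sqrtr_ge0 ?frobenius_ge0 //.
rewrite (sqr_sqrtr d_ge0).
apply: (le_trans (Mx x)); rewrite ler_piMr //.
by rewrite expr_le1 ?frobenius_ge0.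
Qed.

Lemma spectral_norm_ge0 M : 0 <= spectral_norm M.
Proof.
apply: (ub_le_sup (spectral_set_ubound M)).
by exists 0 => /=; rewrite ?mulmx0 frobenius0 ?ler01.
Qed.

Lemma frobenius_mulmx_le M (x : 'cV[C]_n) :
  frobenius_norm (M *m x) <= spectral_norm M * frobenius_norm x.
Proof.
have [x0|x_neq0] := eqVneq (frobenius_norm x) 0.
  by rewrite (frobenius_eq0 x0) mulmx0 !frobenius0 mulr0.
have x_gt0 : 0 < frobenius_norm x by rewrite lt0r x_neq0 frobenius_ge0.
rewrite -ler_pdivrMr // mulrC.
(* The inverse norm is written as an absolute value so that [frobeniusZ] can absorb it into [x],
   giving a unit vector. *)
have := frobenius_ge0 x; rewrite -invr_ge0 => /ger0_norm iE.
rewrite -[X in X * _]iE -frobeniusZ scalemxAr.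
apply: (ub_le_sup (spectral_set_ubound M)).
by exists ((frobenius_norm x)^-1%:C *: x) => //=; rewrite frobeniusZ iE mulVf.
Qed.

Lemma spectral_norm_le M (c : R) : 0 <= c ->
  (forall x : 'cV[C]_n, frobenius_norm (M *m x) <= c * frobenius_norm x) ->
  spectral_norm M <= c.
Proof.
move=> c0 Mc; apply: ge_sup.
  exists (frobenius_norm (M *m (0 : 'cV_n))), 0 => //=.
  by rewrite frobenius0 ler01.
by move=> _ [x /= x1 <-]; apply: le_trans (Mc x) _; rewrite ler_piMr.
Qed.

Lemma mxnormD nk M N : mxnorm nk (M + N) <= mxnorm nk M + mxnorm nk N.
Proof.
case: nk => /=; first exact: frobeniusD.
apply: spectral_norm_le => [|x]; first by rewrite addr_ge0 ?spectral_norm_ge0.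
rewrite mulmxDl mulrDl; apply: le_trans (frobeniusD _ _) _.
by rewrite lerD ?frobenius_mulmx_le.
Qed.

Lemma mxnormN nk M : mxnorm nk (- M) = mxnorm nk M.
Proof.
case: nk => /=; first exact: frobeniusN.
have le N : spectral_norm (- N) <= spectral_norm N.
  apply: spectral_norm_le => [|x]; first exact: spectral_norm_ge0.
  by rewrite mulNmx frobeniusN frobenius_mulmx_le.
by apply/eqP; rewrite eq_le le -{1}[M]opprK le.
Qed.

(** The lower bounds range over all widths [q]: the Frobenius case uses square matrices, the
    spectral case columns. *)
Lemma mxnorm_sylvester_le nk (A B E : 'M[C]_n) (a b : R) :
  0 < a + b ->
  (forall q (X : 'M[C]_(n, q)),
     a * frobenius_norm X ^+ 2 <= re_dot X (A *m X)) ->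
  (forall q (X : 'M[C]_(n, q)),
     b * frobenius_norm X ^+ 2 <= re_dot X (B *m X)) ->
  mxnorm nk E <= (a + b)^-1 * mxnorm nk (A *m E + E *m B).
Proof.
move=> ab_gt0 Aa Bb; rewrite ler_pdivlMl //; set M := A *m E + E *m B.
case: nk => /=.
  have [E0|E_neq0] := eqVneq (frobenius_norm E) 0.
    by rewrite E0 mulr0 frobenius_ge0.
  have E_gt0 : 0 < frobenius_norm E by rewrite lt0r E_neq0 frobenius_ge0.
  have := re_dot_le E M; rewrite re_dotDr.
  (* [B] acts on the right; passing to adjoints lets it act on [E^*] from the left, where its lower
     bound applies. *)
  have -> : re_dot E (E *m B) = re_dot (E ^t*) (B *m E ^t*).
    by rewrite -re_dot_adjoint adjoint_mulmx [RHS]re_dot_mulmxr re_dotC.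
  have := Aa _ E; have := Bb _ (E ^t*); rewrite frobenius_adjoint => h1 h2 h3.
  by rewrite -(ler_pM2l E_gt0); nra.
have [v [d [v1 Ev Ex]]] := top_singular_vector E n_gt0.
have d_ge0 : 0 <= d.
  by have := Ex v; rewrite v1 expr1n mulr1; apply: le_trans; rewrite sqr_ge0.
have sE : Num.sqrt d ^+ 2 = d by rewrite sqr_sqrtr.
have Ed : spectral_norm E <= Num.sqrt d.
  apply: spectral_norm_le => [|x]; first exact: sqrtr_ge0.
  rewrite -(@ler_pXn2r _ 2) ?nnegrE ?mulr_ge0 ?sqrtr_ge0 ?frobenius_ge0 //.
  by rewrite exprMn sE.
have Ev2 : frobenius_norm (E *m v) ^+ 2 = d.
  rewrite -re_dot_xx re_dot_mulmxr re_dotC Ev re_dotZr re_dot_xx.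
  by rewrite v1 expr1n mulr1.
have EvE : frobenius_norm (E *m v) = Num.sqrt d.
  by rewrite -Ev2 sqrtr_sqr ger0_norm ?frobenius_ge0.
apply: le_trans (_ : (a + b) * Num.sqrt d <= _); first by rewrite ler_pM2l.
have [s0|s_neq0] := eqVneq (Num.sqrt d) 0.
  by rewrite s0 mulr0 spectral_norm_ge0.
have s_gt0 : 0 < Num.sqrt d by rewrite lt0r s_neq0 sqrtr_ge0.
(* Moving [E] across the form gives [<E v, E B v> = <E^* E v, B v>], and the singular vector
   equation replaces [E^* E v] by [d v]. *)
have MvE : re_dot (E *m v) (M *m v) =
    re_dot (E *m v) (A *m (E *m v)) + d * re_dot v (B *m v).
  by rewrite mulmxDl re_dotDr -!mulmxA (re_dot_mulmxr E) Ev re_dotZl.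
have := re_dot_le (E *m v) (M *m v); rewrite EvE MvE => EMv.
have := Bb _ v; rewrite v1 expr1n mulr1 => bv.
have := frobenius_mulmx_le M v; rewrite v1 mulr1 => Mv.
rewrite -(ler_pM2l s_gt0).
have : Num.sqrt d * frobenius_norm (M *m v) <= Num.sqrt d * spectral_norm M.
  by rewrite ler_pM2l.
apply: le_trans; apply: le_trans EMv.
(* The left side is now [a d + b d]: the first term is [a |E v|^2], the second is [d] times the
   bound for [B] at the unit vector [v]. *)
rewrite mulrCA -expr2 sE mulrDl lerD // -?Ev2 // Ev2 mulrC.
by rewrite ler_wpM2l.
Qed.
End SpectralNorm.

(** * Residual factorization and accumulation of truncation errors over the restarts *)

Section CompressAndRestart.
Context {R : realType} {n : nat}.
Local Notation C := R[i].

(** [G] is the first Krylov block, present as [0 < m], so it lies in the span of the orthonormal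
    [blocks U m] and is fixed by the projection. *)
Lemma arnoldi_start s (A : 'M[C]_n) (G : 'M[C]_(n, s)) U S m :
  (0 < m)%N -> arnoldi A G U S m ->
  blocks U m *m ((blocks U m) ^t* *m G) = G.
Proof.
move=> m_gt0 [UU UK _].
have /submxP [W /(congr1 trmx)] : ((block_krylov A G m)^T <= (blocks U m)^T)%MS.
  by rewrite UK.
rewrite trmx_mul !trmxK => KE.
have -> : G = blocks U m *m submxrow W^T (Ordinal m_gt0).
  by rewrite mul_submxrow -KE mxrowK /= expr0 mul1mx.
by rewrite (mulmxA (_ ^t*)) UU mul1mx.
Qed.

Lemma residual_factorization s (A B : 'M[C]_n) (Ck Dk : 'M[C]_(n, s)) K m :
  (0 < m)%N -> inner_step A B Ck Dk K m ->
  residual A B Ck Dk K m = hatC K m *m (hatD K m) ^t*.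
Proof.
move=> m_gt0 [arnA arnB Yeq].
have CE := arnoldi_start m_gt0 arnA; have DE := arnoldi_start m_gt0 arnB.
case: arnA => _ _ AU; case: arnB => _ _ /(congr1 (fun M => M ^t*)).
rewrite raddfD raddfD /= !adjoint_mulmx !trmxCK => VB.
rewrite /residual /correction -{1}CE -{1}DE /hatC /hatD.
rewrite tr_row_mx map_col_mx mul_row_col !adjoint_mulmx.
rewrite !mulmxA AU -!(mulmxA _ _ B) VB !mulmxDl !mulmxDr !mulmxA.
(* After the Arnoldi relations are inserted, the terms of the form [U_m (.) V_m^*] add up to the
   lifted projected equation and vanish; the two subdiagonal terms form [hatC] times the adjoint of
   [hatD]. *)
move/(congr1 (fun M => blocks (blkU K) m *m M *m (blocks (blkV K) m) ^t*)): Yeq.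
rewrite mulmx0 mul0mx !mulmxDr !mulmxDl !adjoint_mulmx !trmxCK !mulmxA => Yeq.
by rewrite addrACA [LHS]addrAC Yeq add0r.
Qed.

Section Run.
Context (nk : norm_kind) (s : nat) (A B : 'M[C]_n) (F G : 'M[C]_(n, s)).
Context (mem kmax : nat) (eps delta : R).
Context (n_gt0 : (0 < n)%N).

Lemma mxnorm0 : mxnorm nk (0 : 'M[C]_n) = 0.
Proof.
have := frobenius0 n n; case: nk => //= _; apply/eqP.
rewrite eq_le spectral_norm_ge0 // andbT spectral_norm_le // => x.
by rewrite mul0mx frobenius0 mul0r.
Qed.

Lemma compress_product_le (M M' : 'M[C]_n) :
  compress_product nk delta M M' -> mxnorm nk (M' - M) <= delta.
Proof.
case=> p [q [P [Q [P' [Q' [-> [U [V [sg [r [_ _ _ le_delta]]]]] ->]]]]]].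
by rewrite -opprB mxnormN.
Qed.

(** Induction over the cycles, with [W] the sum of the corrections so far; each restart adds one
    [delta] to both errors. *)
Lemma cycle_start_error k t (Ck Dk : 'M[C]_(n, t)) Xp :
  cycle_start nk A B F G mem kmax eps delta k Ck Dk Xp ->
  exists W : 'M[C]_n,
    mxnorm nk (Xp - W) <= k%:R * delta /\
    mxnorm nk (A *m W + W *m B + F *m G ^t* - Ck *m Dk ^t*) <= k%:R * delta.
Proof.
elim=> [|{}k {}t {}Ck {}Dk {}Xp K m u Ck' Dk' Xk _ [W [XW RW]] _ cyc cX cR].
  by exists 0; rewrite subrr mulmx0 mul0mx !add0r subrr mxnorm0 mul0r.
exists (W + correction K m); split.
  have -> : Xk - (W + correction K m)
      = (Xk - (Xp + correction K m)) + (Xp - W).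
    by apply/matrixP => i j; rewrite !mxE; ring.
  rewrite mulrS mulrDl mul1r; apply: le_trans (mxnormD n_gt0 _ _ _) _.
  exact: lerD (compress_product_le cX) XW.
have [_ [_ _ m_gt0 /(_ m)]] := cyc; rewrite m_gt0 leqnn => /(_ isT) stepm _.
case: cR => U [V [sg [r [_ _ _]]]].
rewrite -(residual_factorization m_gt0 stepm) => Rm.
(* The term [Ck Dk^*] inside [residual] cancels the one from the previous cycle: this is the
   telescoping. *)
have -> : A *m (W + correction K m) + (W + correction K m) *m B + F *m G ^t*
    - Ck' *m Dk' ^t*
  = (A *m W + W *m B + F *m G ^t* - Ck *m Dk ^t*)
    + (residual A B Ck Dk K m - Ck' *m Dk' ^t*).
  rewrite /residual mulmxDr mulmxDl.
  move: (A *m W) (W *m B) (F *m _) (Ck *m _) (A *m _) (_ *m B) (Ck' *m _).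
  by move=> a b c d e f g; apply/matrixP => i j; rewrite !mxE; ring.
rewrite mulrSr mulrDl mul1r; apply: le_trans (mxnormD n_gt0 _ _ _) _.
by rewrite lerD.
Qed.

End Run.
End CompressAndRestart.

Theorem lemma3p1 (R : realType) (nk : norm_kind) (n s : nat) (n_gt0 : (0 < n)%N)
    (A B : 'M[R[i]]_n) (lamA lamB : 'I_n -> R[i])
    (C D : 'M[R[i]]_(n, s)) (X : 'M[R[i]]_n)
    (mem kmax : nat) (eps delta : R) (kbar : nat) (Xk : 'M[R[i]]_n)
    (A_normal : A \is normalmx) (B_normal : B \is normalmx)
    (eigA : ordered_eigenvalues A lamA) (eigB : ordered_eigenvalues B lamB)
    (reA_ge0 : 0 <= complex.Re (lamA (Ordinal n_gt0)))
    (reB_ge0 : 0 <= complex.Re (lamB (Ordinal n_gt0)))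
    (reAB_gt0 : 0 < complex.Re (lamA (Ordinal n_gt0))
                    + complex.Re (lamB (Ordinal n_gt0)))
    (X_sol : A *m X + X *m B + C *m D ^t* = 0)
    (eps_gt0 : 0 < eps) (delta_gt0 : 0 < delta)
    (kbar_lt : (kbar < kmax)%N)
    (run : terminates_with nk A B C D mem kmax eps delta kbar Xk) :
  mxnorm nk (Xk - X) <=
    (complex.Re (lamA (Ordinal n_gt0)) + complex.Re (lamB (Ordinal n_gt0)))^-1
      * (eps + (kbar.+1)%:R * delta)
    + (kbar.+1)%:R * delta.
Proof.
case: run => t [Ck [Dk [Xp [K [m [start [_ _ _ Rm] compX]]]]]].
have [W [XW RW]] := cycle_start_error n_gt0 start.
(* The second group holds the iterate truncations: one from the final cycle and [kbar] from the
   earlier ones. *)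
have XkX : Xk - X = (W + correction K m - X)
    + ((Xk - (Xp + correction K m)) + (Xp - W)).
  by apply/matrixP => i j; rewrite !mxE; ring.
rewrite XkX; apply: le_trans (mxnormD n_gt0 _ _ _) _; apply: lerD; last first.
  apply: le_trans (mxnormD n_gt0 _ _ _) _.
  rewrite mulrS mulrDl mul1r; exact: lerD (compress_product_le n_gt0 compX) XW.
have Anr q Y := @re_dot_normal _ _ q n_gt0 _ _ Y A_normal eigA.
have Bnr q Y := @re_dot_normal _ _ q n_gt0 _ _ Y B_normal eigB.
apply: le_trans (mxnorm_sylvester_le n_gt0 nk _ reAB_gt0 Anr Bnr) _.
rewrite ler_pM2l ?invr_gt0 //.
set E := W + correction K m - X.
have -> : A *m E + E *m B = residual A B Ck Dk K m
    + (A *m W + W *m B + C *m D ^t* - Ck *m Dk ^t*).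
  (* Adding [0 = A X + X B + C D^*] removes [X] and supplies the constant term of the residual. *)
  rewrite -[LHS]addr0 -X_sol /residual /E !(mulmxDl, mulmxDr) !mulmxN !mulNmx.
  move: (A *m X) (X *m B) (C *m _) (A *m W) (W *m B) (Ck *m _)
    (A *m _) (correction K m *m B) => a b c d e f g h.
  by apply/matrixP => i j; rewrite !mxE; ring.
apply: le_trans (mxnormD n_gt0 _ _ _) _; rewrite lerD //.
(* The converged cycle compresses no residual, so only [kbar] truncations enter here; [kbar] is
   relaxed to [kbar + 1]. *)
by apply: le_trans RW _; rewrite ler_wpM2r ?ler_nat // ltW.
Qed.
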